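(* Let $d\ge 2$ and $h\ge 1$ be integers and let $Q_h$ be the transition matrix, defined in the context, of the simple random walk on the complete $d$-ary tree $\mathcal T_h$ of height $h$. (a) $Q_h$ is diagonalizable, with $1$ being an eigenvalue of multiplicity $1$. Every other eigenvalue $\lambda\neq 1$ of $Q_h$ is of the form $$\lambda=\frac{d}{d+1}\left(x+\frac{1}{xd}\right),\qquad (1)$$ where $x\in\mathbb C$, $x\ne\pm\frac1{\sqrt d}$, is a solution of one of the following $h+1$ equations: $$d^{h+1}x^{2h+2}=1\qquad (2)$$ and $$d^{k+2}x^{2k+4}-d^{k+2}x^{2k+3}+dx-1=0\quad\text{for some integer }0\le k\le h-1.\qquad (3)$$ Conversely, each solution $x\ne\pm\frac{1}{\sqrt d}$ of these equations corresponds to an eigenvalue $\lambda$ of $Q_h$ according to (1). For each of these equations, if $x$ is a solution then so is $\frac{1}{xd}$, and both $x$ and $\frac1{xd}$ correspond to the same $\lambda$. The correspondence between $x$ and $\lambda$ is 2-to-1. (b) For each solution $x\neq\pm\frac{1}{\sqrt d}$ of (2), an eigenvector $f_\lambda$ with respect to the corresponding $\lambda$ is given by $$f_\lambda(v)=\frac{dx^2-x}{dx^2-1}\,x^i+\frac{x-1}{dx^2-1}\,\frac{1}{d^ix^i}\quad\text{for every } v \text{ with } \ell(v)=i,\ 0\le i\le h.$$ For each $0\le k\le h-1$, each solution $x\ne\pm\frac1{\sqrt d}$ of (3) for this $k$, each $v\in V(\mathcal T_h)$ with $\ell(v)=h-1-k$, and each $j\in\{1,\dots,d-1\}$, an eigenvector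 $f_{v,j,j+1}$ with respect to the corresponding $\lambda$ is given, with $i=\ell(w)-h+k$, by $$f_{v,j,j+1}(w)=\begin{cases}\dfrac{dx^{i+2}}{dx^2-1}-\dfrac{1}{(dx^2-1)d^ix^i} & \text{if } w\in\mathcal T^v_j,\\[2mm] -\dfrac{dx^{i+2}}{dx^2-1}+\dfrac{1}{(dx^2-1)d^ix^i} & \text{if } w\in\mathcal T^v_{j+1},\\[2mm] 0 & \text{otherwise.}\end{cases}$$ (c) The collection of all the eigenvectors in (b), together with the all-1 vector, forms an eigenbasis of $Q_h$.
   Context: $\mathcal T_h$ is the complete rooted $d$-ary tree of height $h$, with $n=1+d+\dots+d^h=\frac{d^{h+1}-1}{d-1}$ vertices, vertex set $V(\mathcal T_h)$ and root $\rho$; every vertex at distance less than $h$ from $\rho$ has exactly $d$ (ordered) children, and the vertices at distance $h$ are the leaves. $\ell(v)$ denotes the distance of $v$ from the root. For a vertex $v$, $\mathcal T^v$ is the subtree rooted at $v$ consisting of $v$ and all its descendants, and $\mathcal T^v_i$ is the subtree rooted at the $i$-th child of $v$ (that child and all its descendants). The simple random walk on $\mathcal T_h$, with transition matrix $Q_h$: from the root, stay with probability $\frac1{d+1}$ or move to each child with probability $\frac{1}{d+1}$; from a leaf, stay with probability $\frac{d}{d+1}$ and move to its parent with probability $\frac1{d+1}$; from any other vertex, move to each of its $d+1$ neighbors with probability $\frac1{d+1}$. A vector $f:V(\mathcal T_h)\to\mathbb C$ is an eigenvector of $Q_h$ for $\lambda$ if $f\ne0$ and $Q_hf=\lambda f$,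 where $(Q_hf)(v)=\sum_w Q_h(v,w)f(w)$. In (c) the collection is understood as a set of vectors: the two solutions $x$ and $\frac1{xd}$ give the same $\lambda$ and the same eigenvectors, which are counted once.
   Formalization: For d=4 the claim fails at λ=4/5 (it forces x=1/2=1/√d, which is excluded), so ''every other eigenvalue is of the form (1)'' omits λ=4/5 when d=4, and in (c) the collection is shown to be an eigenbasis for d≠4 and only linearly independent eigenvectors for d=4. *)

(* Defs.v *)
From HB Require Import structures.
From mathcomp Require Import all_boot all_order all_algebra.
From mathcomp Require Import reals complex.

Set Implicit Arguments.
Unset Strict Implicit.
Unset Printing Implicit Defensive.

Import Order.TTheory GRing.Theory Num.Theory.
Local Open Scope ring_scope.

(* A vertex is the word of child indices read along the path from the root,
   so the root is the empty word, the level of [v] is [size v], and the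
   subtree rooted at [v] consists of the words having [v] as a prefix.
   Children are numbered from 0. *)
Definition tree (d h : nat) : predArgType := {bseq h of 'I_d}.

Definition level (d h : nat) (v : tree d h) : nat := size v.

Definition child (d h : nat) (v w : tree d h) : bool :=
  [exists i : 'I_d, w == rcons v i :> seq 'I_d].

Definition in_branch (d h : nat) (v : tree d h) (i : 'I_d) (w : tree d h) :
    bool :=
  prefix (rcons v i) w.

Definition Q (R : realType) (d h : nat) (v w : tree d h) : R[i] :=
  if level v == 0%N then
    if (w == v) || child v w then (d.+1%:R)^-1 else 0
  else if level v == h then
    if w == v then d%:R / d.+1%:R
    else if child w v then (d.+1%:R)^-1 else 0
  else if child v w || child w v then (d.+1%:R)^-1 else 0.

Definition Qmx (R : realType) (d h : nat) : 'M[R[i]]_#|tree d h| :=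
  \matrix_(i, j) Q R (enum_val i) (enum_val j).

(* [R[i]^o] rather than [R[i]] gives the type its vector space structure. *)
Notation vec R d h := {ffun tree d h -> R[i]^o}.

Definition eigenvector (R : realType) (d h : nat) (lam : R[i])
    (f : vec R d h) : Prop :=
  f != 0 /\ forall v, \sum_w Q R v w * f w = lam * f v.

Definition eigenval (R : realType) (d h : nat) (lam : R[i]) : Prop :=
  exists f : vec R d h, eigenvector lam f.

Definition lambda (R : realType) (d : nat) (x : R[i]) : R[i] :=
  d%:R / d.+1%:R * (x + (x * d%:R)^-1).

Definition radial_eq (R : realType) (d h : nat) (x : R[i]) : Prop :=
  d%:R ^+ h.+1 * x ^+ (2 * h + 2) = 1.

Definition branch_eq (R : realType) (d k : nat) (x : R[i]) : Prop :=
  d%:R ^+ (k + 2) * x ^+ (2 * k + 4) - d%:R ^+ (k + 2) * x ^+ (2 * k + 3)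
    + d%:R * x - 1 = 0.

Definition nonexceptional (R : realType) (d : nat) (x : R[i]) : Prop :=
  x <> (sqrtC d%:R)^-1 /\ x <> - (sqrtC d%:R)^-1.

Definition admissible (R : realType) (d h : nat) (x : R[i]) : Prop :=
  nonexceptional d x /\
  (radial_eq d h x \/ exists2 k : nat, (k < h)%N & branch_eq d k x).

Definition f_radial (R : realType) (d h : nat) (x : R[i]) : vec R d h :=
  [ffun v : tree d h =>
    (d%:R * x ^+ 2 - x) / (d%:R * x ^+ 2 - 1) * x ^+ level v
    + (x - 1) / (d%:R * x ^+ 2 - 1) * (d%:R ^+ level v * x ^+ level v)^-1].

(* The truncated subtraction defining [i] is only used when
   [level w >= h - k], where it is exact. *)
Definition f_branch (R : realType) (d h k : nat) (x : R[i]) (v : tree d h)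
    (j j' : 'I_d) : vec R d h :=
  [ffun w : tree d h =>
    let i := (level w + k - h)%N in
    let g := d%:R * x ^+ (i + 2) / (d%:R * x ^+ 2 - 1)
             - ((d%:R * x ^+ 2 - 1) * d%:R ^+ i * x ^+ i)^-1 in
    if in_branch v j w then g else if in_branch v j' w then - g else 0].

Definition all_ones (R : realType) (d h : nat) : vec R d h := [ffun=> 1].

Definition eigencollection (R : realType) (d h : nat) (f : vec R d h) : Prop :=
  [\/ f = all_ones R d h,
      exists x : R[i], [/\ nonexceptional d x, radial_eq d h x & f = f_radial d h x]
    | exists k (x : R[i]) (v : tree d h) (j j' : 'I_d),
        [/\ (k < h)%N, nonexceptional d x & branch_eq d k x] /\
        [/\ level v = (h - 1 - k)%N, j' = j.+1 :> nat
          & f = f_branch k x v j j'] ].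

(* Main.v *)
(* [Q] is real symmetric, hence diagonalizable; it remains to describe each
   eigenspace.  Put [mu = (d + 1) * lam = d * x + 1 / x].  A function on a subtree
   that depends only on the level satisfies the eigenvalue equation inside the
   subtree iff its profile solves a recurrence with characteristic roots
   [d * x] and [1 / x] (up to reversal).  Let [psi r] be the solution started at
   the leaves, [r] being the distance to the leaves.  Pairing an eigenfunction
   [f] with [psi] on the subtree of [w] gives
   [f w * psi (r + 1) = f (parent w) * psi r], the root being its own parent.
   So an eigenfunction vanishing above some level vanishes on that level too,
   unless [psi (h + 1) = psi h] at the root, which is the radial equation, or
   [psi (k + 1) = 0] below it, which is the branch equation; in these cases
   subtracting the listed eigenfunctions makes it vanish there.  Descending
   through the levels, the list spans every eigenspace, and no counting of roots
   is needed.  At the exceptional [x = +-1 / sqrt d] the characteristic root is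
   double and [psi] can vanish only for [d = 4], [k = 0].  For freeness, separate
   the eigenvalues; within one eigenvalue the list is triangular with respect to
   the values at the root and at the vertices [rcons v j]. *)

Require Import Defs.
From HB Require Import structures.
From mathcomp Require Import all_boot all_order all_algebra.
From mathcomp Require Import reals complex boolp.
From mathcomp Require Import ring zify.

Set Implicit Arguments.
Unset Strict Implicit.
Unset Printing Implicit Defensive.

Import Order.TTheory GRing.Theory Num.Theory.
Local Open Scope ring_scope.

Ltac nzfield :=
  field; rewrite ?expf_neq0 ?oner_neq0 //; repeat (apply/andP; split);
  rewrite ?expf_neq0 ?oner_neq0 //.

(** * Level recurrences and their explicit solutions *)

Section Recurrences.
Variables (F : fieldType) (q x : F).
Hypotheses (q0 : q != 0) (x0 : x != 0).

Let qn0 n : q ^+ n != 0. Proof. exact: expf_neq0. Qed.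
Let xn0 n : x ^+ n != 0. Proof. exact: expf_neq0. Qed.

Definition radial_profile (i : nat) : F :=
  (q * x ^+ 2 - x) / (q * x ^+ 2 - 1) * x ^+ i
  + (x - 1) / (q * x ^+ 2 - 1) * (q ^+ i * x ^+ i)^-1.

Definition branch_profile (i : nat) : F :=
  q * x ^+ (i + 2) / (q * x ^+ 2 - 1) - ((q * x ^+ 2 - 1) * q ^+ i * x ^+ i)^-1.

(** The combination of the solutions [(q * x) ^+ r] and [x ^- r] that meets the condition at the
    leaves. It is left unnormalized: its value at 0 is [q * x ^+ 2 - 1], and it is identically zero
    when that vanishes. *)
Definition upward_profile (r : nat) : F :=
  (x - 1) * (q * x) ^+ r.+1 + (q * x - 1) / x ^+ r.

Lemma upward_leaf :
  (q * x + x^-1) * upward_profile 0 = q * upward_profile 0 + upward_profile 1.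
Proof. by rewrite /upward_profile; nzfield. Qed.

Lemma upward_step r : (q * x + x^-1) * upward_profile r.+1
  = q * upward_profile r + upward_profile r.+2.
Proof.
rewrite /upward_profile !exprS !exprMn.
by nzfield.
Qed.

(** For [n = h] the third factor is the radial equation; the first two vanish only for the
    eigenvalue 1. *)
Lemma upward_root n : upward_profile n.+1 - upward_profile n
  = (x - 1) * (q * x - 1) * (q ^+ n.+1 * x ^+ (2 * n + 2) - 1) / x ^+ n.+1.
Proof.
rewrite /upward_profile exprD mulnC exprM -exprM mulnC mul2n -addnn exprD.
rewrite !exprS !exprMn.
by nzfield.
Qed.

Lemma upward_branch k : upward_profile k.+1 * x ^+ k.+1
  = q ^+ (k + 2) * x ^+ (2 * k + 4) - q ^+ (k + 2) * x ^+ (2 * k + 3) + q * x - 1.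
Proof.
rewrite /upward_profile mul2n -addnn !exprD !exprS !exprMn.
by nzfield.
Qed.

Hypothesis D0 : q * x ^+ 2 - 1 != 0.

Lemma radial_profile0 : radial_profile 0 = 1.
Proof. by rewrite /radial_profile; nzfield. Qed.

Lemma radial_profile_root :
  (q * x + x^-1) * radial_profile 0 = radial_profile 0 + q * radial_profile 1.
Proof. by rewrite /radial_profile; nzfield. Qed.

Lemma radial_profile_step i : (q * x + x^-1) * radial_profile i.+1
  = radial_profile i + q * radial_profile i.+2.
Proof.
rewrite /radial_profile !exprS.
by nzfield.
Qed.

(** The leaf condition is the interior recurrence continued to a fictitious level that repeats the
    value at the leaves. The increment to that level is a multiple of the radial equation. *)
Lemma radial_profile_leaf n : q ^+ n.+1 * x ^+ (2 * n + 2) = 1 ->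
  radial_profile n.+1 = radial_profile n.
Proof.
move=> Hn; apply/eqP; rewrite -subr_eq0.
suff -> : radial_profile n.+1 - radial_profile n
  = (x - 1) * (q * x - 1) / (q * x ^+ 2 - 1) / q ^+ n.+1 / x ^+ n.+1
    * (q ^+ n.+1 * x ^+ (2 * n + 2) - 1) by rewrite Hn subrr mulr0.
rewrite /radial_profile mul2n -addnn !exprD !exprS.
by nzfield.
Qed.

Lemma branch_profile0 : branch_profile 0 = 1.
Proof. by rewrite /branch_profile; nzfield. Qed.

(** There is no parent term, since the vertex above the branch carries the value 0. *)
Lemma branch_profile_root :
  (q * x + x^-1) * branch_profile 0 = q * branch_profile 1.
Proof. by rewrite /branch_profile; nzfield. Qed.

Lemma branch_profile_step i : (q * x + x^-1) * branch_profile i.+1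
  = branch_profile i + q * branch_profile i.+2.
Proof.
rewrite /branch_profile !exprD !exprS.
by nzfield.
Qed.

Lemma branch_profile_leaf k :
  q ^+ (k + 2) * x ^+ (2 * k + 4) - q ^+ (k + 2) * x ^+ (2 * k + 3)
    + q * x - 1 = 0 ->
  branch_profile k.+1 = branch_profile k.
Proof.
move=> Hk; apply/eqP; rewrite -subr_eq0.
suff -> : branch_profile k.+1 - branch_profile k
  = (q * x ^+ 2 - 1)^-1 / q ^+ k.+1 / x ^+ k.+1
    * (q ^+ (k + 2) * x ^+ (2 * k + 4) - q ^+ (k + 2) * x ^+ (2 * k + 3)
    + q * x - 1) by rewrite Hk mulr0.
rewrite /branch_profile mul2n -addnn !exprD !exprS.
by nzfield.
Qed.

End Recurrences.

(** * The symmetry exchanging [x] and [1 / (x * q)] *)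

Section Inversion.
Variables (F : fieldType) (q x : F).
Hypotheses (q0 : q != 0) (x0 : x != 0).

Let qn0 n : q ^+ n != 0. Proof. exact: expf_neq0. Qed.
Let xn0 n : x ^+ n != 0. Proof. exact: expf_neq0. Qed.

Lemma radial_equation_inv n : q ^+ n.+1 * x ^+ (2 * n + 2) = 1 ->
  q ^+ n.+1 * (x * q)^-1 ^+ (2 * n + 2) = 1.
Proof.
move=> /(congr1 (fun y => y^-1)); rewrite invr1 => <-.
rewrite (_ : 2 * n + 2 = n.+1 + n.+1)%N; last by lia.
rewrite exprVn exprMn !exprD.
by nzfield.
Qed.

Lemma branch_equation_inv k :
  q ^+ (k + 2) * x ^+ (2 * k + 4) - q ^+ (k + 2) * x ^+ (2 * k + 3)
    + q * x - 1 = 0 ->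
  q ^+ (k + 2) * (x * q)^-1 ^+ (2 * k + 4)
    - q ^+ (k + 2) * (x * q)^-1 ^+ (2 * k + 3) + q * (x * q)^-1 - 1 = 0.
Proof.
move=> H; rewrite -[LHS]opprK.
rewrite [X in - X](_ : _ = (q ^+ (k + 2) * x ^+ (2 * k + 4)
  - q ^+ (k + 2) * x ^+ (2 * k + 3) + q * x - 1) / q ^+ (k + 2) / x ^+ (2 * k + 4)).
  by rewrite H !mul0r oppr0.
rewrite !exprVn !exprMn mul2n -addnn !exprD.
by nzfield.
Qed.

Hypothesis D0 : q * x ^+ 2 - 1 != 0.

Let D0' : 1 - q * x ^+ 2 != 0. Proof. by rewrite -oppr_eq0 opprB. Qed.

(** The substitution exchanges the two geometric terms, coefficients included. *)
Lemma radial_profile_inv i : radial_profile q (x * q)^-1 i = radial_profile q x i.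
Proof.
have e : q * (x * q)^-1 ^+ 2 - 1 = (1 - q * x ^+ 2) / (q * x ^+ 2).
  by nzfield.
rewrite /radial_profile e !exprVn !exprMn.
by nzfield.
Qed.

Lemma branch_profile_inv i : branch_profile q (x * q)^-1 i = branch_profile q x i.
Proof.
have e : q * (x * q)^-1 ^+ 2 - 1 = (1 - q * x ^+ 2) / (q * x ^+ 2).
  by nzfield.
rewrite /branch_profile e !exprVn !exprMn !exprD.
by nzfield.
Qed.

End Inversion.

(** * The recurrence with a double characteristic root *)

Section DoubleRoot.
Variables (F : fieldType) (q z : F).
Hypothesis zz : z ^+ 2 = q.

(** Replaces [upward_profile] at the exceptional [x], where [q * x] and [1 / x] coincide; [z] is
    their common value. *)
Definition double_profile (r : nat) : F := (1 + r%:R * (1 - z)) * z ^+ r.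

Lemma double_leaf :
  (2 * z) * double_profile 0 = q * double_profile 0 + double_profile 1.
Proof. by rewrite /double_profile -zz; ring. Qed.

Lemma double_step r : (2 * z) * double_profile r.+1
  = q * double_profile r + double_profile r.+2.
Proof. by rewrite /double_profile -zz -!natr1 !exprS; ring. Qed.

Lemma double_root n : double_profile n.+1 - double_profile n
  = - n.+1%:R * z ^+ n * (1 - z) ^+ 2.
Proof. by rewrite /double_profile -!natr1 !exprS; ring. Qed.

End DoubleRoot.

(* The root is its own parent, which accounts for the loop of the walk there. *)
Definition parent (T : Type) (w : seq T) : seq T := take (size w).-1 w.

Lemma parent_rcons (T : Type) (w : seq T) i : parent (rcons w i) = w.
Proof. by rewrite /parent size_rcons /= -cats1 take_size_cat. Qed.

Lemma size_parent (T : Type) (w : seq T) : size (parent w) = (size w).-1.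
Proof. by rewrite size_take; case: (size w) => //= n; rewrite ltnSn. Qed.

Lemma prefix_rconsE (T : eqType) (c w : seq T) i :
  prefix c (rcons w i) = prefix c w || (c == rcons w i).
Proof.
apply/idP/orP => [/prefixP[t]|[/prefix_trans->//|/eqP->//]]; last 2 first.
- exact: prefix_rcons.
- exact: prefix_refl.
case/lastP: t => [|t j]; first by rewrite cats0 => <-; right.
by rewrite -rcons_cat => /rcons_inj[-> _]; left; apply: prefix_prefix.
Qed.

(** * The walk as a local operator on functions of words *)

Section Tree.
Variables (R : realType) (d h : nat).
Hypotheses (hd : (2 <= d)%N) (hh : (1 <= h)%N).
Local Notation C := R[i].
Local Notation word := (seq 'I_d).
Local Notation q := (d%:R : C).
Implicit Types (w c : word) (v u : tree d h) (f g : vec R d h) (F : word -> C).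

(** This is [d + 1] times the walk operator. Working with functions of arbitrary words makes parents
    and children available without bounds on the length; a leaf counts itself [d] times in place of
    its children. *)
Definition stencil F w : C :=
  F (parent w) + if size w == h then q * F w else \sum_(i < d) F (rcons w i).

Lemma level_le v : (level v <= h)%N. Proof. exact: size_bseq. Qed.

Lemma sum_tree_pick F w : (size w <= h)%N ->
  \sum_(u : tree d h) (bseqval u == w)%:R * F u = F w.
Proof.
move=> wh; rewrite (bigD1 (Bseq wh : tree d h)) //= eqxx mul1r big1 ?addr0 // => u.
by rewrite -val_eqE /= => /negPf->; rewrite mul0r.
Qed.

Lemma childE v u :
  (child v u)%:R = \sum_(i < d) (bseqval u == rcons v i)%:R :> C.
Proof.
case: (boolP (child v u)) => [/existsP[i /eqP ui]|].
  rewrite (bigD1 i) //= -ui eqxx big1 ?addr0 // => j ji.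
  by rewrite ui; case: eqP => // /rcons_inj[ij]; rewrite ij eqxx in ji.
rewrite negb_exists => /forallP nc; rewrite big1 // => i _.
by rewrite (negPf (nc i)).
Qed.

Lemma child_parent v u : child u v = (bseqval v != [::]) && (bseqval u == parent v).
Proof.
apply/existsP/andP => [[i /eqP ->]|].
  by rewrite parent_rcons -size_eq0 size_rcons.
case/lastP: (bseqval v) => [|w i]; first by case.
by rewrite parent_rcons => -[_ /eqP ->]; exists i.
Qed.

Lemma level_child v u : child v u -> level u = (level v).+1.
Proof. by rewrite /level => /existsP[i /eqP ->]; rewrite size_rcons. Qed.

Lemma scaled_QE v u : d.+1%:R * Q R v u
  = (bseqval u == parent v)%:R
    + if size v == h then q * (bseqval u == v)%:R else (child v u)%:R.
Proof.
have d1 : d.+1%:R != 0 :> C by rewrite pnatr_eq0.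
have div1 : d.+1%:R * (d.+1%:R)^-1 = 1 :> C by rewrite divff.
rewrite /Q (_ : level v = size v) //; case: (posnP (size v)) => [v0|vpos].
  have ev : bseqval v = [::] by apply: size0nil.
  (* As [h >= 1], the root is not a leaf. *)
  rewrite v0 [0%N == h]eq_sym eqn0Ngt hh /= ev /parent /= -val_eqE /= ev.
  case: (boolP (child v u)) => [cvu|_].
    have: size u != 0%N by rewrite (level_child cvu : size u = _).
    by rewrite size_eq0 => /negPf->; rewrite div1 add0r.
  by rewrite orbF addr0; case: ifP; rewrite ?mulr0.
have vn0 : bseqval v != [::] by rewrite -size_eq0 -lt0n.
rewrite -val_eqE /= child_parent vn0 /=.
case: (boolP (bseqval u == parent v)) => [/eqP up|_].
  have su : size u = (size v).-1 by rewrite up size_parent.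
  have nuv : (bseqval u == v) = false.
    by apply: contraTF vpos => /eqP uv; rewrite uv in su; rewrite su; lia.
  have ncvu : child v u = false.
    apply/negbTE/negP => /level_child; rewrite /level su; lia.
  by rewrite nuv ncvu /= mulr0; case: ifP; rewrite addr0 div1.
rewrite orbF add0r; case: ifP => _; case: ifP => _; rewrite ?mulr0 ?mulr1 //.
by rewrite mulrC divfK.
Qed.

Lemma stencilE F v :
  d.+1%:R * (\sum_u Q R v u * F (bseqval u)) = stencil F v.
Proof.
rewrite mulr_sumr; under eq_bigr do rewrite mulrA scaled_QE mulrDl.
rewrite big_split /= sum_tree_pick ?size_parent; last first.
  by rewrite (leq_trans (leq_pred _)) ?size_bseq.
congr (_ + _); case: ifP => [_|nleaf].
  under eq_bigr do rewrite -mulrA.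
  by rewrite -mulr_sumr sum_tree_pick ?size_bseq.
under eq_bigr do rewrite childE mulr_suml.
rewrite exchange_big; apply: eq_bigr => i _.
by rewrite sum_tree_pick // size_rcons ltn_neqAle nleaf size_bseq.
Qed.

(** Off the diagonal all three cases of [Q] amount to [1 / (d + 1)] on edges, because the root is no
    child and a leaf has none. *)
Lemma Q_sym v u : Q R v u = Q R u v.
Proof.
have d1 : d.+1%:R != 0 :> C by rewrite pnatr_eq0.
suff aux (a b : tree d h) : a != b ->
    Q R a b = if child a b || child b a then (d.+1%:R)^-1 else 0.
  have [->//|vu] := eqVneq v u.
  by rewrite (aux v u) // (aux u v) 1?orbC // eq_sym.
move=> ab; rewrite /Q [b == a]eq_sym (negPf ab) /=.
case: (posnP (level a)) => [a0|_].
  have -> : child b a = false; last by rewrite orbF.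
  by apply/negbTE/negP => /level_child; rewrite a0.
case: (eqVneq (level a) h) => [ah|//].
rewrite /= (_ : child a b = false) //.
by apply/negbTE/negP => /level_child e; have := level_le b; rewrite e ah ltnn.
Qed.

Definition sector c (g : nat -> C) : word -> C :=
  fun w => if prefix c w then g (size w - size c)%N else 0.

(* A radial function on the subtree below [c] satisfies the eigenvalue equation
   with [mu = (d + 1) * lam], except for defects at [c] and at its parent;
   if [c] is the root, both defects sit at the root. *)
Lemma sector_stencil c (g : nat -> C) (mu a : C) :
  (size c <= h)%N ->
  mu * g 0%N - q * g (size c != h) = a ->
  (forall i, (size c + i.+1 < h)%N -> mu * g i.+1 = g i + q * g i.+2) ->
  (forall i, (size c + i.+1 = h)%N -> mu * g i.+1 = g i + q * g i.+1) ->
  forall w, (size w <= h)%N ->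
  stencil (sector c g) w
  = mu * sector c g w + (w == parent c)%:R * g 0%N - (w == c)%:R * a.
Proof.
move=> ch g0 gstep gleaf w wh.
case: (boolP (prefix c w)) => [/prefixP[t tw]|npw].
  subst w; case/lastP: t wh => [|t i] wh.
    rewrite cats0 eqxx mul1r -g0 {wh}.
    (* The boolean serves as an index: 1 for the children of an interior [c], 0 for [c] itself when
       it is a leaf. *)
    have e : (if size c == h then q * sector c g c
              else \sum_(i < d) sector c g (rcons c i)) = q * g (size c != h).
      case: eqP => ch' /=; first by rewrite /sector prefix_refl subnn.
      rewrite (eq_bigr (fun=> g 1%N)) => [|i _].
        by rewrite sumr_const card_ord mulr_natl.
      by rewrite /sector prefix_rcons size_rcons subSnn.
    rewrite /stencil e [in RHS]/sector prefix_refl subnn.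
    (* The parent of [c] lies in the subtree only when [c] is the root. *)
    have -> : sector c g (parent c) = (c == parent c)%:R * g 0%N; last by ring.
    case/lastP: c {ch g0 gstep gleaf e} => [|c i].
      by rewrite /sector /= mul1r.
    have -> : (rcons c i == parent (rcons c i)) = false.
      apply/eqP => /(congr1 size); rewrite parent_rcons size_rcons => /eqP.
      by rewrite eqn_leq ltnn.
    rewrite /sector parent_rcons mul0r; case: ifP => // /size_prefix.
    by rewrite size_rcons ltnn.
  have sE j s : sector c g (c ++ rcons s j) = g (size s).+1.
    by rewrite /sector prefix_prefix size_cat size_rcons addKn.
  have sE0 : sector c g (parent (c ++ rcons t i)) = g (size t).
    by rewrite -rcons_cat parent_rcons /sector prefix_prefix size_cat addKn.
  have -> : (c ++ rcons t i == parent c) = false.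
    apply/eqP => /(congr1 size); rewrite size_parent size_cat size_rcons; lia.
  have -> : (c ++ rcons t i == c) = false.
    apply/eqP => /(congr1 size); rewrite size_cat size_rcons; lia.
  rewrite !mul0r addr0 subr0 sE.
  rewrite /stencil sE0 sE.
  rewrite size_cat size_rcons in wh *.
  case: eqP => wh'; first by rewrite gleaf.
  rewrite gstep; last by lia.
  rewrite (eq_bigr (fun=> g (size t).+2)) => [|j _].
    by rewrite sumr_const card_ord mulr_natl.
  by rewrite rcons_cat sE size_rcons.
(* Outside the subtree, the only possible contribution comes from [c] as a child of [w]. *)
have wc : (w == c) = false by apply: contraNF npw => /eqP ->; apply: prefix_refl.
have S0 : sector c g w = 0 by rewrite /sector (negPf npw).
have P0 : sector c g (parent w) = 0.
  rewrite /sector; case: ifP => // pcw; case/negP: npw.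
  by apply: prefix_trans pcw _; rewrite prefixE size_parent eqxx.
rewrite /stencil S0 P0 wc mul0r subr0 !mulr0 !add0r.
case/lastP: c ch {g0 gstep gleaf} npw wc S0 P0 => [|c j] ch npw wc S0 P0.
  by rewrite prefix0s in npw.
rewrite size_rcons in ch; rewrite parent_rcons.
case: eqP => wh'.
  case: eqP => [wc'|_]; last by rewrite mul0r.
  by exfalso; move: ch; rewrite -wc' wh'; lia.
transitivity (\sum_(i < d) ((c == w) && (j == i))%:R * g 0%N).
  apply: eq_bigr => i _; rewrite /sector prefix_rconsE (negPf npw) /= eqseq_rcons.
  case: andP => [[/eqP-> /eqP->]|_]; last by rewrite mul0r.
  by rewrite !size_rcons subnn mul1r.
rewrite [w == c]eq_sym (bigD1 j) //= eqxx andbT big1 ?addr0 // => i.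
by rewrite eq_sym => /negPf ->; rewrite andbF mul0r.
Qed.

End Tree.

(** * Eigenfunctions and summation by parts *)

Section Eigenfunctions.
Variables (R : realType) (d h : nat).
Hypotheses (hd : (2 <= d)%N) (hh : (1 <= h)%N).
Local Notation C := R[i].
Local Notation word := (seq 'I_d).
Local Notation q := (d%:R : C).
Implicit Types (w c : word) (v u : tree d h) (f g : vec R d h) (F : word -> C).
Implicit Types (x lam mu : C).

(* Unlike [eigenvector], this allows [f = 0]. *)
Definition eigenfun lam f : Prop := forall v, \sum_u Q R v u * f u = lam * f v.

Lemma eigenfun_lin lam a f g :
  eigenfun lam f -> eigenfun lam g -> eigenfun lam (a *: f + g).
Proof.
move=> Ef Eg v; rewrite !ffunE mulrDr -Eg mulrCA -Ef mulr_sumr -big_split /=.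
by apply: eq_bigr => u _; rewrite !ffunE mulrDr mulrCA.
Qed.

Lemma eigenfun0 lam : eigenfun lam 0.
Proof. by move=> v; rewrite big1 ?ffunE ?mulr0 // => u _; rewrite ffunE mulr0. Qed.

Lemma eigenfunZ lam a f : eigenfun lam f -> eigenfun lam (a *: f).
Proof. by move=> Ef; rewrite -[a *: f]addr0; apply: eigenfun_lin Ef (eigenfun0 _). Qed.

Lemma eigenfunB lam f g :
  eigenfun lam f -> eigenfun lam g -> eigenfun lam (f - g).
Proof. by move=> Ef Eg; rewrite addrC -scaleN1r; apply: eigenfun_lin. Qed.

Lemma eigenfun_sum lam (I : Type) (r : seq I) (P : pred I) (G : I -> vec R d h) :
  (forall i, P i -> eigenfun lam (G i)) ->
  eigenfun lam (\sum_(i <- r | P i) G i).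
Proof.
move=> EG; elim/big_ind: _ => //; first exact: eigenfun0.
by move=> f g Ef Eg; rewrite -[f]scale1r; apply: eigenfun_lin.
Qed.

(** Words longer than [h] receive the value at the root as a default; the walk never reaches
    them. *)
Definition extend f : word -> C := fun w => f (insub_bseq h w).

Lemma extendE f v : extend f (bseqval v) = f v.
Proof. by rewrite /extend /insub_bseq valKd. Qed.

Lemma eigenfun_stencil lam f v : eigenfun lam f ->
  stencil h (extend f) v = d.+1%:R * lam * f v.
Proof.
move=> Ef; rewrite -stencilE // -mulrA -Ef; congr (_ * _).
by apply: eq_bigr => u _; rewrite extendE.
Qed.

Definition sector_vec c (g : nat -> C) : vec R d h :=
  [ffun v : tree d h => sector c g (bseqval v)].

(** The condition at the leaves is stated through a fictitious level below them. If [c] is itself a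
    leaf, it gives [g 1 = g 0], so the defect at [c] has the same form in every case. *)
Lemma sector_vec_Q lam c (g : nat -> C) :
  (size c <= h)%N ->
  (forall i, d.+1%:R * lam * g i.+1 = g i + q * g i.+2) ->
  g (h - size c).+1 = g (h - size c)%N ->
  forall v, d.+1%:R * (\sum_u Q R v u * sector_vec c g u)
    = d.+1%:R * lam * sector_vec c g v + (bseqval v == parent c)%:R * g 0%N
      - (bseqval v == c)%:R * (d.+1%:R * lam * g 0%N - q * g 1%N).
Proof.
move=> ch gstep gleaf v.
under eq_bigr do rewrite ffunE.
rewrite (stencilE hd hh (sector c g)) ffunE; apply: sector_stencil => //.
- case: eqP => // sc; rewrite sc subnn in gleaf.
  by rewrite gleaf.
- by move=> i si; rewrite gstep (_ : i.+2 = (h - size c).+1) ?gleaf //=;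
    [congr (_ + _ * g _)|]; lia.
- exact: size_bseq.
Qed.

(* Summation by parts of [f] against the function on the subtree below [w] that
   depends through [psi] on the distance to the leaves: the latter solves the
   eigenvalue equation except at [w] and its parent. *)
Lemma eigenfun_transfer lam f (psi : nat -> C) w :
  eigenfun lam f ->
  d.+1%:R * lam * psi 0%N = q * psi 0%N + psi 1%N ->
  (forall r, d.+1%:R * lam * psi r.+1 = q * psi r + psi r.+2) ->
  (size w <= h)%N ->
  extend f w * psi (h - size w).+1 = extend f (parent w) * psi (h - size w)%N.
Proof.
move=> Ef psi0 psistep wh; set k := (h - size w)%N.
pose g i := psi (k - i)%N.
have st := @sector_stencil R d h hd hh w g (d.+1%:R * lam) (psi k.+1) wh.
(* By symmetry of [Q] the operator moves onto [f], where it acts as multiplication by [lam]. *)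
have : \sum_(v : tree d h) f v * (stencil h (sector w g) v
         - d.+1%:R * lam * sector w g v) = 0.
  under eq_bigr do rewrite mulrBr.
  rewrite sumrB; apply/eqP; rewrite subr_eq0; apply/eqP.
  transitivity (d.+1%:R * \sum_(u : tree d h) sector w g u * (\sum_v Q R u v * f v)).
    under eq_bigr do rewrite -stencilE // mulrCA mulr_sumr.
    rewrite -mulr_sumr exchange_big /=; congr (_ * _); apply: eq_bigr => u _.
    rewrite mulr_sumr; apply: eq_bigr => v _.
    by rewrite (Q_sym R v u); ring.
  rewrite mulr_sumr; apply: eq_bigr => u _; rewrite Ef; ring.
have gE0 : g 0%N = psi k by rewrite /g subn0.
rewrite (eq_bigr (fun v : tree d h => (bseqval v == parent w)%:R * (extend f v * psi k)
  - (bseqval v == w)%:R * (extend f v * psi k.+1))); last first.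
  move=> v _; rewrite extendE st ?size_bseq //.
  - have distr (y m G a b s t : C) : y * (m * G + a * s - b * t - m * G)
        = a * (y * s) - b * (y * t) by ring.
    by rewrite gE0 distr.
  (* The defect at [w] is the next value [psi k.+1]; at a leaf this is the initial condition,
     elsewhere the recurrence. *)
  - rewrite gE0; case: eqP => sw /=.
      have k0 : k = 0%N by rewrite /k sw subnn.
      by rewrite gE0 k0 psi0 addrAC subrr add0r.
    have kE : k = k.-1.+1 by rewrite /k; lia.
    by rewrite /g subn1 kE /= psistep addrAC subrr add0r.
  - move=> i si; rewrite /g.
    have -> : (k - i = (k - i.+2).+2)%N by rewrite /k; lia.
    have -> : (k - i.+1 = (k - i.+2).+1)%N by rewrite /k; lia.
    by rewrite psistep addrC.
  - move=> i si; rewrite /g.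
    have -> : (k - i = 1)%N by rewrite /k; lia.
    have -> : (k - i.+1 = 0)%N by rewrite /k; lia.
    by rewrite psi0 addrC.
rewrite sumrB (sum_tree_pick (fun u : word => extend f u * psi k)); last first.
  by rewrite size_parent (leq_trans (leq_pred _)).
by rewrite (sum_tree_pick (fun u : word => extend f u * psi k.+1)) // => /eqP;
  rewrite subr_eq0 => /eqP.
Qed.

End Eigenfunctions.

(** * Descent through the levels *)

Section Span.
Variables (R : realType) (d h : nat).
Hypotheses (hd : (2 <= d)%N) (hh : (1 <= h)%N).
Local Notation C := R[i].
Local Notation word := (seq 'I_d).
Local Notation q := (d%:R : C).
Implicit Types (w c : word) (v u : tree d h) (f g : vec R d h) (F : word -> C).
Implicit Types (x lam mu : C).

Lemma extend_tree f w (wh : (size w <= h)%N) : extend f w = f (Bseq wh : tree d h).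
Proof. by rewrite -[RHS]extendE. Qed.

Lemma sector_short c (g : nat -> C) w : g 0%N = 1 -> (size w <= size c)%N ->
  sector c g w = (w == c)%:R.
Proof.
move=> g0 wc; rewrite /sector; case: ifP => [/prefixP[t wE]|npw].
  have t0 : t = [::] by apply/eqP; rewrite -size_eq0 -leqn0 -(leq_add2l (size c)) addn0 -size_cat -wE.
  by rewrite wE t0 cats0 subnn eqxx.
by case: eqP npw => // ->; rewrite prefix_refl.
Qed.

(** Keeping [psi] abstract covers simple and double characteristic roots alike. Each hypothesis
    provides, for a level where [psi] allows nonzero values, eigenfunctions in [W] that cancel those
    values. *)
Lemma eigenfun_sub lam (psi : nat -> C) (W : {vspace vec R d h}) f :
  d.+1%:R * lam * psi 0%N = q * psi 0%N + psi 1%N ->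
  (forall r, d.+1%:R * lam * psi r.+1 = q * psi r + psi r.+2) ->
  (psi h.+1 = psi h ->
    exists2 e, e \in W /\ eigenfun lam e & e [bseq] = 1) ->
  (forall k, (k < h)%N -> psi k.+1 = 0 ->
    exists2 g : nat -> C, g 0%N = 1 &
    forall v (j j' : 'I_d), level v = (h - 1 - k)%N ->
    let e := sector_vec h (rcons v j) g - sector_vec h (rcons v j') g in
    e \in W /\ eigenfun lam e) ->
  eigenfun lam f -> f \in W.
Proof.
move=> psi0 psistep Hroot Hbranch.
(* Here [n] counts the bottom levels on which [f] may be nonzero; going from [k.+1] to [k] clears
   level [h - k]. *)
suff main n : forall f, eigenfun lam f ->
    (forall v, (level v + n < h.+1)%N -> f v = 0) -> f \in W.
  move=> Ef; apply: (main h.+1 _ Ef) => v; lia.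
elim: n {f} => [|k IH] f Ef vanish.
  suff -> : f = 0 by exact: mem0v.
  by apply/ffunP => v; rewrite ffunE vanish // addn0 ltnS level_le.
have transfer := fun w => eigenfun_transfer hd hh Ef psi0 psistep (w := w).
have [hk|kh] := leqP h k.
  have [kh|hk'] := eqVneq k h; last first.
    by apply: IH Ef _ => v; move: hk hk'; lia.
  have [f0|fn0] := eqVneq (f [bseq]) 0.
    apply: IH Ef _ => v vk; rewrite -f0; congr (f _); apply: val_inj => /=.
    by apply: size0nil; move: vk; rewrite /level /= kh; lia.
  (* At the root, its own parent, the transfer identity has the nonzero factor [f [bseq]] on both
     sides. *)
  case: Hroot => [|e [eW Ee] e1].
    have := transfer [::] isT; rewrite subn0 /parent /=.
    by rewrite (extendE f [bseq]) => /(mulfI fn0).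
  rewrite -[f](subrK (f [bseq] *: e)) rpredD ?memvZ //.
  apply: IH; first by apply: eigenfunB => //; apply: eigenfunZ.
  move=> v vk; rewrite (_ : v = [bseq]); last first.
    apply: val_inj => /=; apply: size0nil; move: vk.
    by rewrite /level kh; lia.
  by rewrite !ffunE e1 /GRing.scale /= mulr1 subrr.
have vanishw w : (size w + k < h)%N -> extend f w = 0.
  move=> wk; have wh : (size w <= h)%N by lia.
  by rewrite (extend_tree f wh) vanish //= /level /=; lia.
(* If [psi k.+1] is nonzero, the zero values on the level above force zeros on level [h - k]. *)
have [psik|psik] := eqVneq (psi k.+1) 0; last first.
  apply: IH Ef _ => v; rewrite ltnS leq_eqVlt => /orP[/eqP vk|]; last first.
    by rewrite -extendE => /vanishw.
  have := transfer (bseqval v) (size_bseq v).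
  rewrite (vanishw (parent v)); last by rewrite size_parent; move: vk kh; rewrite /level; lia.
  rewrite mul0r extendE (_ : (h - size v)%N = k); last by move: vk kh; rewrite /level; lia.
  by move/eqP; rewrite mulf_eq0 (negPf psik) orbF => /eqP.
have [g g0 Hg] := Hbranch k kh psik.
(* Differences against one reference child suffice: by [children0], the values of [f] at the
   children of each [v] sum to zero. *)
have j0 : 'I_d by exact: Ordinal hd.
pose D v j := sector_vec h (rcons v j) g - sector_vec h (rcons v j0) g.
pose G := \sum_(v | level v == (h - 1 - k)%N)
            \sum_(j < d) extend f (rcons v j) *: D v j.
have GW : G \in W.
  apply: rpred_sum => v /eqP vk; apply: rpred_sum => j _.
  by apply: memvZ; case: (Hg v j j0 vk).
rewrite -[f](subrK G) rpredD //; apply: IH.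
  apply: eigenfunB => //; apply: eigenfun_sum => v /eqP vk.
  by apply: eigenfun_sum => j _; apply: eigenfunZ; case: (Hg v j j0 vk).
move=> u uk; rewrite !ffunE; apply/eqP; rewrite subr_eq0; apply/eqP.
have children0 v : level v = (h - 1 - k)%N -> \sum_(j < d) extend f (rcons v j) = 0.
  move=> vk; have := eigenfun_stencil hd hh v Ef.
  rewrite /stencil -[f v]extendE !vanishw ?size_parent;
    [|by move: vk kh; rewrite /level; lia..].
  by rewrite !mulr0 add0r; case: eqP => // vh; move: vk kh; rewrite /level vh; lia.
(* The value [f u] is written as a sum over candidate parents to match the outer sum in [G]. The
   root, which is not its own child, causes no mismatch since [f] vanishes there. *)
transitivity (\sum_(v : tree d h) (bseqval v == parent u)%:R * f u).
  by rewrite (sum_tree_pick (fun=> f u)) // size_parent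
    (leq_trans (leq_pred _)) ?size_bseq.
rewrite sum_ffunE [RHS]big_mkcond; apply: eq_bigr => v _.
have -> : (bseqval v == parent u)%:R * f u = (child v u)%:R * f u.
  rewrite child_parent; case: (eqVneq (bseqval u) [::]) => //= u0.
  by rewrite -[f u]extendE vanishw ?mulr0 // u0 /=.
case: eqP => vk; last first.
  case: (boolP (child v u)) => [cvu|_]; last by rewrite mul0r.
  rewrite -[f u]extendE vanishw ?mulr0 //.
  by move: uk vk; rewrite -/(level u) (level_child cvu); lia.
rewrite childE mulr_suml sum_ffunE.
(* The reference terms have total coefficient zero. *)
transitivity (\sum_(j < d) extend f (rcons v j) * sector (rcons v j) g u
   - (\sum_(j < d) extend f (rcons v j)) * sector (rcons v j0) g u).
  rewrite children0 // mul0r subr0; apply: eq_bigr => j _.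
  rewrite sector_short //; last first.
    by rewrite size_rcons -[size u]/(level u) -[size v]/(level v) vk; lia.
  by case: eqP => [<-|]; rewrite ?mulr0 ?mul0r // extendE mulrC.
rewrite mulr_suml -sumrB; apply: eq_bigr => j _.
by rewrite !ffunE -mulrBr.
Qed.

End Span.

(** * The eigenvalue map and the listed functions *)

Section Collection.
Variables (R : realType) (d h : nat).
Hypotheses (hd : (2 <= d)%N) (hh : (1 <= h)%N).
Local Notation C := R[i].
Local Notation word := (seq 'I_d).
Local Notation q := (d%:R : C).
Implicit Types (w c : word) (v u : tree d h) (f g : vec R d h).
Implicit Types (x z lam mu : C).

Let q0 : q != 0. Proof. by rewrite pnatr_eq0 -lt0n ltnW. Qed.
Let d1 : d.+1%:R != 0 :> C. Proof. by rewrite pnatr_eq0. Qed.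
Let d1' : q + 1 != 0. Proof. by rewrite natr1. Qed.

Lemma nonexceptionalP x : nonexceptional d x <-> q * x ^+ 2 - 1 != 0.
Proof.
have s2 := sqrtCK q.
have s0 : sqrtC q != 0 by rewrite sqrtC_eq0.
have -> : q * x ^+ 2 - 1 = (sqrtC q * (x - (sqrtC q)^-1)) * (sqrtC q * (x + (sqrtC q)^-1)).
  by rewrite -{1}s2; field.
rewrite !mulf_eq0 (negPf s0) /= subr_eq0 addr_eq0 negb_or.
split=> [[/eqP -> /eqP ->//]|/andP[/eqP ? /eqP ?]]; by split.
Qed.

Lemma radial_eq_neq0 x : radial_eq d h x -> x != 0.
Proof.
rewrite /radial_eq; case: eqVneq => // ->.
by rewrite expr0n addn2 mulr0 => /eqP; rewrite eq_sym oner_eq0.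
Qed.

Lemma branch_eq_neq0 k x : branch_eq d k x -> x != 0.
Proof.
rewrite /branch_eq; case: eqVneq => // ->.
rewrite !expr0n addn4 addn3 !mulr0 subr0 !add0r => /eqP.
by rewrite oppr_eq0 oner_eq0.
Qed.

Lemma admissible_neq0 x : admissible d h x -> x != 0.
Proof. by case=> _ [/radial_eq_neq0|[k _ /branch_eq_neq0]]. Qed.

Lemma scaled_lambda x : x != 0 -> d.+1%:R * lambda d x = q * x + x^-1.
Proof. by move=> x0; rewrite /lambda -natr1; nzfield. Qed.

Lemma lambda_inv x : x != 0 -> lambda d (x * q)^-1 = lambda d x.
Proof. by move=> x0; rewrite /lambda -natr1; nzfield. Qed.

(** For a given eigenvalue, [x] is a root of a quadratic whose two roots have product [1 / q]. *)
Lemma lambda_eq x z : x != 0 -> z != 0 ->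
  lambda d x = lambda d z <-> x = z \/ x = (z * q)^-1.
Proof.
move=> x0 z0; split=> [e|[->//|->]]; last exact: lambda_inv.
have : (x - z) * (x - (z * q)^-1) = 0.
  have -> : (x - z) * (x - (z * q)^-1)
      = x / q * (d.+1%:R * lambda d x - d.+1%:R * lambda d z).
    by rewrite !scaled_lambda //; nzfield.
  by rewrite e subrr mulr0.
by move/eqP; rewrite mulf_eq0 !subr_eq0 => /orP[/eqP|/eqP]; [left|right].
Qed.

Lemma lambda_eq1 x : x != 0 -> (lambda d x == 1) = (x == 1) || (q * x == 1).
Proof.
move=> x0; rewrite -(inj_eq (mulfI d1)) scaled_lambda // mulr1 -subr_eq0.
rewrite (_ : _ - _ = (x - 1) * (q * x - 1) / x).
  by rewrite !mulf_eq0 !subr_eq0 invr_eq0 (negPf x0) orbF.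
by rewrite -natr1; nzfield.
Qed.

(** Solve [q * x ^+ 2 - mu * x + 1 = 0] over the complex numbers; the constant term excludes
    [x = 0]. *)
Lemma lambda_onto lam : exists2 x, x != 0 & lam = lambda d x.
Proof.
pose mu := d.+1%:R * lam; pose s := sqrtC (mu ^+ 2 - 4%:R * q).
have s2 : s ^+ 2 = mu ^+ 2 - 4%:R * q by rewrite sqrtCK.
pose x := (mu + s) / (2%:R * q).
have xE : q * x ^+ 2 - mu * x + 1 = 0.
  have -> : q * x ^+ 2 - mu * x + 1
      = (s ^+ 2 - (mu ^+ 2 - 4%:R * q)) / (4%:R * q).
    by rewrite /x; field; exact: q0.
  by rewrite s2 subrr mul0r.
have x0 : x != 0.
  apply/eqP => x0; move: xE; rewrite x0 expr0n !mulr0 subrr add0r => /eqP.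
  by rewrite oner_eq0.
exists x => //; apply: (mulfI d1); rewrite scaled_lambda // -/mu.
apply/eqP; rewrite eq_sym -subr_eq0.
have -> : q * x + x^-1 - mu = (q * x ^+ 2 - mu * x + 1) / x by nzfield.
by rewrite xE mul0r.
Qed.

Lemma radial_eq_inv x : radial_eq d h x -> radial_eq d h (x * q)^-1.
Proof. by move=> e; apply: radial_equation_inv (radial_eq_neq0 e) _ e. Qed.

Lemma branch_eq_inv k x : branch_eq d k x -> branch_eq d k (x * q)^-1.
Proof. by move=> e; apply: branch_equation_inv (branch_eq_neq0 e) _ e. Qed.

Lemma nonexceptional_inv x : x != 0 -> nonexceptional d x ->
  nonexceptional d (x * q)^-1.
Proof.
move=> x0 /nonexceptionalP D0; apply/nonexceptionalP.
have -> : q * (x * q)^-1 ^+ 2 - 1 = - (q * x ^+ 2 - 1) / (q * x ^+ 2) by nzfield.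
by rewrite mulf_neq0 ?oppr_eq0 // invr_eq0 mulf_neq0 // expf_neq0.
Qed.

Lemma admissible_inv x : admissible d h x -> admissible d h (x * q)^-1.
Proof.
move=> ax; have x0 := admissible_neq0 ax; case: ax => nx eqs.
split; first exact: nonexceptional_inv.
by case: eqs => [/radial_eq_inv|[k kh /branch_eq_inv]]; [left|right; exists k].
Qed.

(** Eigenvalue 1 means [x = 1] or [x = 1 / q], and inversion exchanges these. At [x = 1] the
    equations become [q ^+ h.+1 = 1] and [q = 1], both impossible for [d >= 2]. *)
Lemma admissible_lambda_neq1 x : admissible d h x -> lambda d x <> 1.
Proof.
move=> ax; have x0 := admissible_neq0 ax; apply/eqP; rewrite lambda_eq1 //.
suff root1 z : admissible d h z -> z != 1.
  rewrite negb_or root1 //=; apply: contra (root1 _ (admissible_inv ax)).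
  by rewrite mulrC => /eqP ->; rewrite invr1.
have qpow n : (q ^+ n.+1 == 1) = false.
  by rewrite -natrX pnatr_eq1; apply/negbTE; rewrite neq_ltn (ltn_exp2l 0) ?orbT.
case=> _ eqs; apply/eqP => z1; subst z; case: eqs => [|[k kh]].
  by rewrite /radial_eq expr1n mulr1 => /eqP; rewrite qpow.
rewrite /branch_eq !expr1n !mulr1 subrr add0r => /eqP.
by rewrite subr_eq0 -[q]expr1 qpow.
Qed.

Lemma f_radialE x : f_radial d h x = sector_vec h [::] (radial_profile q x).
Proof. by apply/ffunP => v; rewrite !ffunE /sector prefix0s subn0. Qed.

Lemma f_branchE k x v (j j' : 'I_d) : (k < h)%N -> level v = (h - 1 - k)%N ->
  j != j' ->
  f_branch k x v j j' = sector_vec h (rcons v j) (branch_profile q x)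
                        - sector_vec h (rcons v j') (branch_profile q x).
Proof.
move=> kh vk jj'; apply/ffunP => w; rewrite !ffunE /in_branch /sector !size_rcons.
rewrite -[size v]/(level v) vk -[size w]/(level w).
(* Both truncated subtractions give the depth of [w] below the top of the branch. *)
have -> : (level w - (h - 1 - k).+1 = level w + k - h)%N by lia.
case: ifP => pj; last by case: ifP; rewrite sub0r ?oppr0.
case: ifP => pj'; last by rewrite subr0.
case/prefixP: pj pj' => t ->; rewrite cat_rcons -cats1 prefix_catr // eqxx.
by rewrite prefix_cons eq_sym (negPf jj').
Qed.

Lemma f_radial_inv x : x != 0 -> nonexceptional d x ->
  f_radial d h (x * q)^-1 = f_radial d h x.
Proof.
move=> x0 /nonexceptionalP D0; rewrite !f_radialE; apply/ffunP => v.
by rewrite !ffunE /sector radial_profile_inv.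
Qed.

Lemma f_branch_inv k x v (j j' : 'I_d) : x != 0 -> nonexceptional d x ->
  f_branch k (x * q)^-1 v j j' = f_branch k x v j j'.
Proof.
move=> x0 /nonexceptionalP D0; apply/ffunP => w; rewrite !ffunE.
by have := branch_profile_inv q0 x0 D0; rewrite /branch_profile => ->.
Qed.

Lemma f_radial_root x : nonexceptional d x -> f_radial d h x [bseq] = 1.
Proof.
move=> /nonexceptionalP D0.
by rewrite f_radialE ffunE /sector prefix0s radial_profile0.
Qed.

Lemma f_radial_eigenfun x : nonexceptional d x -> radial_eq d h x ->
  eigenfun (lambda d x) (f_radial d h x).
Proof.
move=> /nonexceptionalP D0 e v; have x0 := radial_eq_neq0 e.
apply: (mulfI d1); rewrite f_radialE (sector_vec_Q hd hh (lam := lambda d x)) //.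
- by rewrite [RHS]mulrA scaled_lambda // radial_profile_root // !addrK.
- by move=> i; rewrite scaled_lambda // radial_profile_step.
- by rewrite subn0 radial_profile_leaf.
Qed.

(** Each of the two sectors violates the eigenvalue equation only at [v], and by the same amount 1,
    so the defects cancel. *)
Lemma branch_difference_eigenfun k x v (j j' : 'I_d) : (k < h)%N ->
  nonexceptional d x -> branch_eq d k x -> level v = (h - 1 - k)%N ->
  eigenfun (lambda d x) (sector_vec h (rcons v j) (branch_profile q x)
                         - sector_vec h (rcons v j') (branch_profile q x)).
Proof.
move=> kh /nonexceptionalP D0 e vk u; have x0 := branch_eq_neq0 e.
have sect i : d.+1%:R * (\sum_w Q R u w * sector_vec h (rcons v i) (branch_profile q x) w)
    = d.+1%:R * lambda d x * sector_vec h (rcons v i) (branch_profile q x) u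
      + (bseqval u == v)%:R.
  rewrite (sector_vec_Q hd hh (lam := lambda d x)) //.
  - by rewrite parent_rcons branch_profile0 // mulr1 scaled_lambda // 
      -branch_profile_root // branch_profile0 // subrr mulr0 subr0.
  - by rewrite size_rcons -[size v]/(level v) vk; lia.
  - by move=> n; rewrite scaled_lambda // branch_profile_step.
  - rewrite size_rcons -[size v]/(level v) vk.
    have -> : (h - (h - 1 - k).+1 = k)%N by lia.
    by rewrite branch_profile_leaf.
apply: (mulfI d1); set f := sector_vec h (rcons v j) _; set g := sector_vec h _ _.
have subE (w : tree d h) : (f - g) w = f w - g w by rewrite ffunE [X in _ + X]ffunE.
under eq_bigr => w _ do rewrite subE mulrBr.
by rewrite sumrB mulrBr !sect subE; ring.
Qed.

End Collection.

(** Already [(n + 2) ^ 2 < 2 * (n + 1) ^ 2] for [n >= 2], and 4 does not divide 9. *)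
Lemma square_ratio n d : (2 <= d)%N -> (n.+2 ^ 2 = d * n.+1 ^ 2)%N ->
  n = 0%N /\ d = 4%N.
Proof.
rewrite -!mulnn => d2; case: n => [|[|n]] e; first by split=> //; lia.
  by exfalso; lia.
by exfalso; nia.
Qed.

(** * Determination of the eigenspaces *)

Section EigenfunctionsKnown.
Variables (R : realType) (d h : nat).
Hypotheses (hd : (2 <= d)%N) (hh : (1 <= h)%N).
Local Notation C := R[i].
Local Notation word := (seq 'I_d).
Local Notation q := (d%:R : C).
Implicit Types (w c : word) (v u : tree d h) (f g : vec R d h).
Implicit Types (x z lam mu : C).

Lemma eigenvector_pivot lam f v : eigenfun lam f -> f v = 1 -> eigenvector lam f.
Proof.
move=> Ef fv; split=> //; apply/eqP => f0; move/eqP: fv.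
by rewrite f0 ffunE eq_sym oner_eq0.
Qed.

(** These values give both the nonvanishing of the branch functions and their triangularity. *)
Lemma f_branch_pivot k x v (j j' : 'I_d) w : (k < h)%N -> nonexceptional d x ->
  level v = (h - 1 - k)%N -> j != j' -> (size w <= (level v).+1)%N ->
  extend (f_branch k x v j j') w = (w == rcons v j)%:R - (w == rcons v j')%:R.
Proof.
move=> kh /(nonexceptionalP hd) D0 vk jj' ws.
have wh : (size w <= h)%N by rewrite (leq_trans ws) // vk; lia.
rewrite (extend_tree _ wh) f_branchE // !ffunE /=.
by rewrite !sector_short ?branch_profile0 ?size_rcons.
Qed.

Lemma f_branch_eigenvector k x v (j j' : 'I_d) : (k < h)%N ->
  nonexceptional d x -> branch_eq d k x -> level v = (h - 1 - k)%N -> j != j' ->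
  eigenvector (lambda d x) (f_branch k x v j j').
Proof.
move=> kh nx e vk jj'.
have wh : (size (rcons v j) <= h)%N by rewrite size_rcons -[size v]/(level v) vk; lia.
apply: (@eigenvector_pivot _ _ (Bseq wh)).
  by rewrite f_branchE //; apply: (branch_difference_eigenfun hd hh _ _ kh).
rewrite -extendE f_branch_pivot // ?size_rcons //=.
by rewrite eqxx eqseq_rcons eqxx (negPf jj') subr0.
Qed.

Lemma f_radial_eigenvector x : nonexceptional d x -> radial_eq d h x ->
  eigenvector (lambda d x) (f_radial d h x).
Proof.
move=> nx e; apply: (@eigenvector_pivot _ _ [bseq]); first exact: f_radial_eigenfun.
exact: f_radial_root.
Qed.

Lemma eigenfun_all_ones : eigenfun 1 (all_ones R d h).
Proof.
move=> v; have d1 : d.+1%:R != 0 :> C by rewrite pnatr_eq0.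
apply: (mulfI d1); rewrite ffunE !mulr1.
under eq_bigr do rewrite ffunE.
rewrite (stencilE hd hh (fun=> 1)) /stencil sumr_const card_ord mulr1 if_same.
by rewrite -natr1 addrC.
Qed.

(** For the eigenvalue 1 a constant [psi] is allowed, and the transfer identity equates [f] at a
    vertex and its parent. *)
Lemma eigenfun1 f : eigenfun 1 f -> f = f [bseq] *: all_ones R d h.
Proof.
move=> Ef; apply/ffunP => v; rewrite !ffunE /GRing.scale /= mulr1.
have const w : (size w <= h)%N -> extend f w = extend f [::].
  elim/last_ind: w => // w i IH wh.
  have := eigenfun_transfer hd hh (psi := fun=> 1) (w := rcons w i) Ef.
  rewrite !mulr1 parent_rcons -natr1 addrC => -> //.
  by apply: IH; rewrite size_rcons in wh; apply: ltnW.
by rewrite -(extendE f v) const ?size_bseq // (extendE f [bseq]).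
Qed.

(** With [W = 0] this shows that a non-admissible [x] gives no eigenvalue; with [W] the span of the
    list it gives completeness. *)
Lemma eigenfun_nonexceptional x (W : {vspace vec R d h}) f :
  x != 0 -> nonexceptional d x -> lambda d x <> 1 ->
  (radial_eq d h x -> f_radial d h x \in W) ->
  (forall k v (j j' : 'I_d), (k < h)%N -> branch_eq d k x ->
     level v = (h - 1 - k)%N -> j' = j.+1 :> nat -> f_branch k x v j j' \in W) ->
  eigenfun (lambda d x) f -> f \in W.
Proof.
move=> x0 nx l1 HR HB; have D0 := (nonexceptionalP hd x).1 nx.
have xn n : x ^+ n != 0 by rewrite expf_neq0.
apply: (eigenfun_sub hd hh (psi := upward_profile q x)).
- by rewrite scaled_lambda // upward_leaf.
- by move=> r; rewrite scaled_lambda // upward_step.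
- move=> e; have rx : radial_eq d h x.
    move: (upward_root q x0 h); rewrite e subrr => /esym/eqP.
    rewrite !mulf_eq0 invr_eq0 (negPf (xn _)) orbF => /orP[|].
      by rewrite !subr_eq0 -lambda_eq1 // => /eqP.
    by rewrite subr_eq0 => /eqP.
  exists (f_radial d h x); last exact: f_radial_root.
  by split; [apply: HR | apply: f_radial_eigenfun].
move=> k kh e; have bx : branch_eq d k x.
  by have := upward_branch q x0 k; rewrite e mul0r.
exists (branch_profile q x); first by rewrite branch_profile0.
move=> v j j' vk; split; last exact: (branch_difference_eigenfun hd hh _ _ kh).
(* The list contains only differences of consecutive children; the others are obtained by
   telescoping from child 0. *)
set S := fun j => sector_vec h (rcons v j) (branch_profile q x).
suff down n : forall (i i' : 'I_d), i = 0%N :> nat -> i' = n :> nat -> S i - S i' \in W.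
  pose z : 'I_d := Ordinal (ltnW hd).
  rewrite -/(S j) -/(S j') (_ : S j - S j' = (S z - S j') - (S z - S j)).
    by rewrite rpredB //; apply: down.
  by rewrite opprB [RHS]addrC addrA subrK.
elim: n => [|n IH] i i' i0 i'n.
  by rewrite (_ : i' = i) ?subrr ?mem0v //; apply: val_inj; rewrite /= i0.
have nd : (n < d)%N by rewrite ltnW // -i'n.
rewrite (_ : S i - S i' = (S i - S (Ordinal nd)) + (S (Ordinal nd) - S i')); last first.
  by rewrite addrA subrK.
apply: rpredD; first exact: IH.
rewrite -(f_branchE hd hh x kh vk); first exact: HB.
by rewrite -val_eqE /= i'n neq_ltn ltnSn.
Qed.

(** The descent runs with [W = 0], so both resonances of [double_profile] have to be refuted. *)
Lemma eigenfun_exceptional x f : x != 0 -> ~ nonexceptional d x ->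
  ~ (d = 4%N /\ lambda d x = 4%:R / 5%:R) ->
  eigenfun (lambda d x) f -> f = 0.
Proof.
move=> x0 nnx n4 Ef; pose z := x^-1.
have D0 : q * x ^+ 2 = 1.
  apply/eqP; rewrite -subr_eq0; apply: contra_notT nnx.
  by move/(nonexceptionalP hd).
have zq : q * x = z by apply: (mulIf x0); rewrite -mulrA -expr2 D0 mulVf.
have zz : z ^+ 2 = q.
  by apply: (mulIf (expf_neq0 2 x0)); rewrite D0 -exprMn mulVf ?expr1n.
have z0 : z != 0 by rewrite invr_eq0.
have mu : d.+1%:R * lambda d x = 2 * z.
  by rewrite scaled_lambda // -/z zq mulr_natl.
have z1 : 1 - z != 0.
  apply: contraTneq hd => /eqP; rewrite subr_eq0 => /eqP z1.
  by move: zz; rewrite -z1 expr1n => /eqP; rewrite eq_sym pnatr_eq1 => /eqP ->.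
suff : f \in 0%VS by rewrite memv0 => /eqP.
apply: (eigenfun_sub hd hh (psi := double_profile z) _ _ _ _ Ef).
- by rewrite mu (double_leaf zz).
- by move=> r; rewrite mu (double_step zz).
- move=> e; have := double_root z h; rewrite e subrr => /esym/eqP.
  by rewrite !mulf_eq0 oppr_eq0 pnatr_eq0 !expf_eq0 (negPf z0) (negPf z1) andbF.
(* A zero of [psi] gives [z * (k + 1) = k + 2]; squaring turns this into an equation between natural
   numbers. *)
move=> k kh /eqP; rewrite mulf_eq0 expf_eq0 (negPf z0) andbF orbF => /eqP e.
have zk : z * k.+1%:R = k.+2%:R.
  apply/eqP; rewrite -subr_eq0 -oppr_eq0; apply/eqP; rewrite -[RHS]e -natr1; ring.
have : (k.+2 ^ 2 = d * k.+1 ^ 2)%N.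
  by apply/eqP; rewrite -(eqr_nat C) natrM !natrX -zk exprMn zz.
move=> /(square_ratio hd)[k0 d4]; case: n4; split => //.
move: zk; rewrite k0 mulr1 => z2.
apply: (@mulfI _ d.+1%:R); first by rewrite pnatr_eq0.
by rewrite mu z2 d4; field.
Qed.

End EigenfunctionsKnown.

(** * Diagonalization and the multiplicity of the eigenvalue 1 *)

Lemma char_poly_conj (F : fieldType) n (P D : 'M[F]_n) : P \in unitmx ->
  char_poly (invmx P *m D *m P) = char_poly D.
Proof.
move=> Pu; rewrite /char_poly /char_poly_mx.
have -> : 'X%:M - map_mx polyC (invmx P *m D *m P)
    = map_mx polyC (invmx P) *m ('X%:M - map_mx polyC D) *m map_mx polyC P.
  rewrite mulmxBr mulmxBl !map_mxM; congr (_ - _).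
  by rewrite scalar_mxC -mulmxA -map_mxM mulVmx // map_mx1 mulmx1.
rewrite !det_mulmx mulrAC -det_mulmx -map_mxM mulVmx // map_mx1 det1 mul1r //.
Qed.

Section Spectral.
Variables (R : realType) (d h : nat).
Hypotheses (hd : (2 <= d)%N) (hh : (1 <= h)%N).
Local Notation C := R[i].
Implicit Types (v u : tree d h) (f g : vec R d h) (lam : C).
Local Notation A := (Qmx R d h).

Lemma Q_real v u : Q R v u \is Num.real.
Proof. by rewrite /Q; repeat case: ifP => _; rewrite ?rpredV ?rpred_div ?rpred_nat ?rpred0. Qed.

Lemma Qmx_spectral : exists2 PD : 'M[C]_#|tree d h| * 'rV[C]_#|tree d h|,
  PD.1 \in unitmx & A = invmx PD.1 *m diag_mx PD.2 *m PD.1.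
Proof.
have sA : A \is symmetricmx.
  by apply/is_hermitianmxP; rewrite expr0 scale1r; apply/matrixP => i j; rewrite !mxE Q_sym.
have rA : A \is a realmx by apply/mxOverP => i j; rewrite mxE Q_real.
have /orthomx_spectralP e := symmetric_normalmx sA rA.
by exists (spectralmx A, spectral_diag A) => //=; exact: spectral_unit.
Qed.

Lemma Qmx_diagonalizable : diagonalizable A.
Proof.
have [[P D] /= Pu e] := Qmx_spectral.
by exists P => //; apply/(similar_diagLR Pu); exists D; rewrite conjVmx.
Qed.

Section Diagonalization.
Variables (P : 'M[C]_#|tree d h|) (D : 'rV[C]_#|tree d h|).
Hypotheses (Pu : P \in unitmx) (AE : A = invmx P *m diag_mx D *m P).

Definition row_vec (i : 'I_#|tree d h|) : vec R d h :=
  [ffun v => P i (enum_rank v)].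

Lemma row_vec_eigenfun i : eigenfun (D 0 i) (row_vec i).
Proof.
have PA : P *m A = diag_mx D *m P by rewrite AE !mulmxA mulmxV // mul1mx.
move=> v; move/matrixP/(_ i (enum_rank v)): PA.
rewrite mul_diag_mx !mxE ffunE => <-.
rewrite (reindex (@enum_rank (tree d h))) /=; last first.
  by apply: onW_bij; exists enum_val; [apply: enum_rankK | apply: enum_valK].
by apply: eq_bigr => u _; rewrite ffunE !mxE !enum_rankK Q_sym mulrC.
Qed.

Lemma row_vec_span f : exists a : 'I_#|tree d h| -> C, f = \sum_i a i *: row_vec i.
Proof.
pose r : 'rV[C]_#|tree d h| := \row_j f (enum_val j).
exists (fun i => (r *m invmx P) 0 i); apply/ffunP => v; rewrite sum_ffunE.
have -> : f v = (r *m invmx P *m P) 0 (enum_rank v).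
  by rewrite mulmxKV // mxE enum_rankK.
by rewrite mxE; apply: eq_bigr => i _; rewrite !ffunE.
Qed.

Lemma row_vec_indep i j a b : i != j -> b *: row_vec i = a *: row_vec j -> b = 0.
Proof.
move=> ij e; have : b *: row i P = a *: row j P.
  apply/rowP => k; rewrite !mxE -[k]enum_valK.
  by move/ffunP/(_ (enum_val k)): e; rewrite !ffunE.
move/(congr1 (mulmxr (invmx P))) => /=.
rewrite -!scalemxAl -!row_mul mulmxV // => /rowP/(_ i).
by rewrite !mxE eqxx eq_sym (negPf ij) !mulr0 mulr1.
Qed.

Lemma row_vec_neq0 i : row_vec i != 0.
Proof.
apply/eqP => e; have : row i P = 0.
  apply/rowP => k; rewrite !mxE -[k]enum_valK.
  by move/ffunP/(_ (enum_val k)): e; rewrite !ffunE.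
move/(congr1 (mulmxr (invmx P))) => /=.
rewrite mul0mx -row_mul mulmxV // => /rowP/(_ i).
by rewrite !mxE eqxx => /eqP; rewrite oner_eq0.
Qed.

End Diagonalization.

Lemma eigenfun_span (W : {vspace vec R d h}) :
  (forall lam f, eigenfun lam f -> f \in W) -> W = fullv.
Proof.
have [[P D] /= Pu e] := Qmx_spectral => HW.
apply/vspaceP => f; rewrite memvf.
have [a ->] := row_vec_span Pu f.
by apply: rpred_sum => i _; apply: memvZ; apply: HW (row_vec_eigenfun Pu e i).
Qed.

(** The multiplicity counts the diagonal entries equal to 1. Two of them would give independent rows
    of [P] that are both multiples of [all_ones]. *)
Lemma mup_char_poly1 : mup 1 (char_poly A) = 1%N.
Proof.
have [[P D] /= Pu e] := Qmx_spectral.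
have cE : char_poly A = \prod_(y <- [seq D 0 i | i : 'I_#|tree d h|]) ('X - y%:P).
  rewrite e char_poly_conj // char_poly_trig ?diag_mx_is_trig //.
  rewrite big_image /=; apply: eq_bigr => i _.
  by rewrite !mxE eqxx.
have /mapP[i _ iE] : 1 \in [seq D 0 i | i : 'I_#|tree d h|].
  rewrite -root_prod_XsubC -cE -eigenvalue_root_char.
  apply/eigenvalueP; exists (const_mx 1).
    rewrite scale1r; apply/rowP => j; rewrite !mxE.
    rewrite (reindex (@enum_rank (tree d h))) /=; last first.
      by apply: onW_bij; exists enum_val; [apply: enum_rankK | apply: enum_valK].
    have := eigenfun_all_ones R hd hh (enum_val j : tree d h).
    rewrite ffunE mul1r => {2}<-; apply: eq_bigr => u _.
    by rewrite ffunE !mxE enum_rankK Q_sym mulrC.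
  apply/eqP => /rowP/(_ (enum_rank ([bseq] : tree d h))).
  by rewrite !mxE => /eqP; rewrite oner_eq0.
rewrite cE mu_prod_XsubC count_map -sum1_count big_enum_cond /=.
rewrite (big_pred1 i) // => j; rewrite !inE /=.
have [-> |ji] := eqVneq j i; first by rewrite -iE eqxx.
apply/negbTE/negP => /eqP jE.
have E1 l : D 0 l = 1 -> row_vec P l = row_vec P l [bseq] *: all_ones R d h.
  by move=> lE; apply: (eigenfun1 hd hh); rewrite -lE; apply: row_vec_eigenfun.
have /(row_vec_indep Pu ji) : row_vec P i [bseq] *: row_vec P j
    = row_vec P j [bseq] *: row_vec P i.
  by rewrite (E1 j jE) (E1 i (esym iE)) !scalerA !ffunE /GRing.scale /= !mulr1 mulrC.
move=> i0; move: (row_vec_neq0 Pu i); rewrite (E1 i (esym iE)) i0.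
by rewrite scale0r eqxx.
Qed.

End Spectral.

(** * Linear independence from eigenvalues and pivots *)

Section Free.
Variables (R : realType) (d h : nat).
Local Notation C := R[i].
Implicit Types (v u : tree d h) (f g : vec R d h).

(** Applying [Q - l0] to the relation removes the first term and multiplies each other term by the
    nonzero scalar [l - l0]. *)
Lemma eigenfun_sum0 (L : seq C) (F : C -> vec R d h) : uniq L ->
  (forall l, l \in L -> eigenfun l (F l)) -> \sum_(l <- L) F l = 0 ->
  forall l, l \in L -> F l = 0.
Proof.
elim: L F => // l0 L IH F /= /andP[l0L uL] EF F0.
have FL l : l \in L -> F l = 0.
  move=> lL; have l0l : l - l0 != 0.
    by rewrite subr_eq0; apply: contraNneq l0L => <-.
  suff /eqP : (l - l0) *: F l = 0 by rewrite scaler_eq0 (negPf l0l) => /eqP.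
  apply: (IH (fun l => (l - l0) *: F l) uL) lL => [m mL|].
    by apply: eigenfunZ; apply: EF; rewrite inE mL orbT.
  apply/ffunP => v; have QF : \sum_(l <- l0 :: L) l * F l v = 0.
    under eq_big_seq => m mL do rewrite -EF //.
    rewrite exchange_big big1 // => u _.
    by rewrite -mulr_sumr -sum_ffunE F0 ffunE mulr0.
  have : \sum_(l <- l0 :: L) (l * F l v - l0 * F l v) = 0.
    by rewrite sumrB QF -mulr_sumr -sum_ffunE F0 ffunE mulr0 subr0.
  rewrite big_cons subrr add0r sum_ffunE ffunE => e.
  by rewrite -[RHS]e; apply: eq_bigr => m _; rewrite ffunE -mulrBl.
move=> l; rewrite inE => /predU1P[->|]; last exact: FL.
by move: F0; rewrite big_cons big_seq big1 ?addr0.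
Qed.

(* Within one eigenvalue the vectors are triangular with respect to the pivots,
   ordered by rank. *)
Lemma free_pivots (s : seq (vec R d h)) (lam : vec R d h -> C)
    (p : vec R d h -> tree d h) (r : vec R d h -> nat) : uniq s ->
  (forall f, f \in s -> eigenfun (lam f) f /\ f (p f) != 0) ->
  (forall f g, f \in s -> g \in s -> f <> g -> lam f = lam g ->
     (r f <= r g)%N -> g (p f) = 0) ->
  free s.
Proof.
move=> us Hs Hpiv; apply/(freeP (X := in_tuple s)) => a a0.
have ns (i : 'I_(size s)) : s`_i \in s by exact: mem_nth.
pose F l := \sum_(i < size s | lam s`_i == l) a i *: s`_i.
pose L := undup [seq lam f | f <- s].
have lamL i : lam s`_(i : 'I_(size s)) \in L.
  by rewrite mem_undup; apply: map_f.
have F0 i : F (lam s`_(i : 'I_(size s))) = 0.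
  apply: (@eigenfun_sum0 L F) => //; first exact: undup_uniq.
    move=> l _; apply: eigenfun_sum => j /eqP <-; apply: eigenfunZ.
    by case: (Hs _ (ns j)).
  rewrite -[RHS]a0 (exchange_big_dep predT) //=; apply: eq_bigr => j _.
  rewrite (eq_bigl (pred1 (lam s`_j))) => [|l]; last exact: eq_sym.
  by rewrite -big_filter filter_pred1_uniq ?undup_uniq ?lamL // big_seq1.
move=> i0; apply/eqP; apply: contraT => ai0.
(* Take a nonzero coefficient of least rank: at its pivot, every other term with the same eigenvalue
   vanishes. *)
have [i ai imin] := @arg_minnP _ i0 (fun i => a i != 0) (fun i => r s`_i) ai0.
have /ffunP/(_ (p s`_i)) := F0 i.
rewrite sum_ffunE (bigD1 i) //= big1 => [|j /andP[/eqP lj ji]].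
  rewrite addr0 !ffunE => /eqP; rewrite mulf_eq0 (negPf ai) /=.
  by case: (Hs _ (ns i)) => _ /negPf ->.
rewrite ffunE; have [->|aj] := eqVneq (a j) 0; first by rewrite scale0r.
rewrite (Hpiv s`_i s`_j) ?scaler0 ?imin //.
by apply/eqP; rewrite nth_uniq // eq_sym.
Qed.

End Free.

(** * Enumeration and freeness of the collection *)

Lemma root_list (F : closedFieldType) (b : pred F) (p : {poly F}) : p.[0] != 0 ->
  exists X : seq F, forall x, x \in X <-> b x /\ p.[x] = 0.
Proof.
move=> p0; have pn0 : p != 0 by apply: contraNneq p0 => ->; rewrite horner0.
have [rs pE] := closed_field_poly_normal p.
exists [seq x <- rs | b x] => x; rewrite mem_filter -root_prod_XsubC.
rewrite -(rootZ _ _ (a := lead_coef p)) ?lead_coef_eq0 // -pE.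
by split=> [/andP[-> /rootP]|[-> /rootP]].
Qed.

Section Listing.
Variables (R : realType) (d h : nat).
Hypotheses (hd : (2 <= d)%N) (hh : (1 <= h)%N).
Local Notation C := R[i].
Local Notation q := (d%:R : C).
Implicit Types (v u : tree d h) (f g : vec R d h) (x : C).

Lemma radial_list : exists X : seq C, forall x,
  x \in X <-> nonexceptional d x /\ radial_eq d h x.
Proof.
have [|X HX] := root_list (fun x => q * x ^+ 2 - 1 != 0)
    (p := q ^+ h.+1 *: 'X^(2 * h + 2) - 1).
  rewrite !hornerE expr0n addn2 mulr0 sub0r oppr_eq0 oner_eq0 //.
exists X => x; rewrite HX /= -(nonexceptionalP hd) !hornerE /radial_eq.
by split=> [[? /subr0_eq]|[? ->]]; rewrite ?subrr.
Qed.

Lemma branch_list k : exists X : seq C, forall x,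
  x \in X <-> nonexceptional d x /\ branch_eq d k x.
Proof.
have [|X HX] := root_list (fun x => q * x ^+ 2 - 1 != 0)
    (p := q ^+ (k + 2) *: 'X^(2 * k + 4) - q ^+ (k + 2) *: 'X^(2 * k + 3) + q *: 'X - 1).
  rewrite !hornerE !expr0n addn4 addn3 !mulr0 subr0 sub0r.
  by rewrite oppr_eq0 oner_eq0.
exists X => x; rewrite HX /= -(nonexceptionalP hd) !hornerE /branch_eq //.
Qed.

Lemma eigencollection_list : exists2 s : seq (vec R d h), uniq s &
  forall f, f \in s <-> eigencollection f.
Proof.
have [X HX] := radial_list; have [Y HY] := boolp.choice branch_list.
pose T : finType := ('I_h * tree d h * 'I_d * 'I_d)%type.
pose cond (t : T) := let: (k, v, j, j') := t in
  (level v == (h - 1 - k)%N) && (j' == j.+1 :> nat).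
pose fB (t : T) := let: (k, v, j, j') := t in
  [seq f_branch k x v j j' | x <- Y k].
(* Duplicates do occur, since [x] and [1 / (x * d)] give the same vector. *)
exists (undup (all_ones R d h :: [seq f_radial d h x | x <- X]
               ++ flatten [seq fB t | t <- enum cond])); first exact: undup_uniq.
move=> f; rewrite mem_undup inE mem_cat; split.
  case/predU1P => [->|]; first by constructor 1.
  case/orP => [/mapP[x /HX[nx ex] ->]|]; first by constructor 2; exists x.
  case/flatten_mapP => -[[[k v] j] j'].
  rewrite mem_enum => /andP[/eqP vk /eqP jj'] /mapP[x /HY[nx ex] ->].
  by constructor 3; exists k, x, v, j, j'.
case=> [->|[x [nx ex ->]]|[k [x [v [j [j' [[kh nx ex] [vk jj' ->]]]]]]]].
- by rewrite eqxx.
- by apply/orP; right; apply/orP; left; apply: map_f; apply/HX.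
apply/orP; right; apply/orP; right.
apply/flatten_mapP; exists (Ordinal kh, v, j, j').
  by rewrite mem_enum; apply/andP; split; apply/eqP.
by apply: (map_f (fun x => f_branch k x v j j')); apply/HY.
Qed.

(** The triple consists of an eigenvalue, a pivot and a rank. Ranks put the functions with pivot at
    the root first, then order branch functions by the level of [v] and next by [j]. *)
Definition pivot_data f (t : C * tree d h * nat) : Prop :=
  let: (lam, p, r) := t in
  [\/ [/\ f = all_ones R d h, lam = 1, p = [bseq] & r = 0%N],
      exists x, [/\ nonexceptional d x, radial_eq d h x, f = f_radial d h x
        & [/\ lam = lambda d x, p = [bseq] & r = 0%N]]
    | exists k x v (j j' : 'I_d),
        [/\ (k < h)%N, nonexceptional d x & branch_eq d k x] /\
        [/\ level v = (h - 1 - k)%N, j' = j.+1 :> nat, f = f_branch k x v j j'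
          & [/\ lam = lambda d x, bseqval p = rcons v j
              & r = (level v * d + j).+1]] ].

Lemma pivot_data_ex f : exists t, eigencollection f -> pivot_data f t.
Proof.
have [cf|ncf] := EM (eigencollection f); last by exists (0, [bseq], 0%N).
case: cf => [->|[x [nx ex ->]]|[k [x [v [j [j' [[kh nx ex] [vk jj' ->]]]]]]]].
- by exists (1, [bseq], 0%N) => _; constructor 1.
- by exists (lambda d x, [bseq], 0%N) => _; constructor 2; exists x.
have ph : (size (rcons v j) <= h)%N.
  by rewrite size_rcons -[size v]/(level v) vk; lia.
exists (lambda d x, Bseq ph, (level v * d + j).+1) => _.
by constructor 3; exists k, x, v, j, j'.
Qed.

Lemma pivot_data_eigenfun f lam p r : pivot_data f (lam, p, r) ->
  eigenfun lam f /\ f p = 1.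
Proof.
case=> [[-> -> -> _]|[x [nx ex -> [-> -> _]]]
  |[k [x [v [j [j' [[kh nx ex] [vk jj' -> [-> pE _]]]]]]]]].
- by split; [exact: eigenfun_all_ones | rewrite ffunE].
- by split; [exact: f_radial_eigenfun | exact: f_radial_root].
have nj : j != j' by rewrite -val_eqE /= jj' neq_ltn ltnSn.
split; first by case: (f_branch_eigenvector hd hh kh nx ex vk nj).
rewrite -extendE pE f_branch_pivot ?size_rcons //.
by rewrite eqxx eqseq_rcons eqxx (negPf nj) subr0.
Qed.

Lemma pivot_triangular f g lam p r p' r' :
  pivot_data f (lam, p, r) -> pivot_data g (lam, p', r') -> f <> g ->
  (r <= r')%N -> g p = 0.
Proof.
have radial_adm x : nonexceptional d x -> radial_eq d h x -> admissible d h x.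
  by move=> nx ex; split=> //; left.
have branch_adm k x : (k < h)%N -> nonexceptional d x -> branch_eq d k x ->
    admissible d h x.
  by move=> kh nx ex; split=> //; right; exists k.
case=> [[-> -> -> _]|[x [nx ex -> [-> -> _]]]
  |[k [x [v [j [j' [[kh nx ex] [vk jj' -> [-> pE ->]]]]]]]]].
- case=> [[-> //]|[x [nx ex _ [l1 _ _]]]
    |[k [x [v [j [j' [[kh nx ex] [_ _ _ [l1 _ _]]]]]]]]] _ _.
  + by case: (admissible_lambda_neq1 hd (radial_adm x nx ex) (esym l1)).
  by case: (admissible_lambda_neq1 hd (branch_adm k x kh nx ex) (esym l1)).
- have ax := radial_adm x nx ex; have x0 := admissible_neq0 ax.
  case=> [[_ l1]|[z [nz ez -> [lz _ _]]]
    |[k [z [v [j [j' [[kh nz ez] [vk jj' -> _]]]]]]]] fg _.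
  + by case: (admissible_lambda_neq1 hd ax l1).
  (* Equal eigenvalues leave only [x] and its inverse, which define the same radial function. *)
  + case: fg; have z0 := radial_eq_neq0 ez.
    by case: ((lambda_eq hd x0 z0).1 lz) => -> //; rewrite f_radial_inv.
  have nj : j != j' by rewrite -val_eqE /= jj' neq_ltn ltnSn.
  rewrite -(extendE _ [bseq]) f_branch_pivot //=.
  by case: (bseqval v) => //= *; rewrite subrr.
have ax := branch_adm k x kh nx ex; have x0 := admissible_neq0 ax.
case=> [[_ l1]|[z [nz ez -> [lz _ ->]]]
  |[m [z [u [i [i' [[mh nz ez] [um ii' -> [lz _ ->]]]]]]]]] fg //.
  by case: (admissible_lambda_neq1 hd ax l1).
rewrite ltnS => rr.
have ni : i != i' by rewrite -val_eqE /= ii' neq_ltn ltnSn.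
(* As [i < d], the rank order compares levels first. *)
have vu : (level v <= level u)%N.
  by rewrite leqNgt; apply/negP => uv; have := ltn_ord i; nia.
rewrite -extendE pE f_branch_pivot ?size_rcons // !eqseq_rcons.
case: (eqVneq (bseqval v) u) => [/val_inj evu|_]; last by rewrite subrr.
subst u; have mk : m = k by move: vk; rewrite um; lia.
subst m; have [ij|ji] := eqVneq j i.
  subst i; case: fg; have z0 := branch_eq_neq0 ez.
  have -> : i' = j' by apply: val_inj; rewrite /= ii' jj'.
  by case: ((lambda_eq hd x0 z0).1 lz) => -> //; rewrite f_branch_inv.
(* The remaining nonzero value of [g], at its second child [i + 1], would give [f] the larger
   rank. *)
have [ji'|_] := eqVneq j i'; last by rewrite subrr.
by move: rr; rewrite ji' ii'; lia.
Qed.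

Lemma eigencollection_free (s : seq (vec R d h)) : uniq s ->
  (forall f, f \in s -> eigencollection f) -> free s.
Proof.
move=> us Hs; have [t Ht] := boolp.choice pivot_data_ex.
have piv f : f \in s -> pivot_data f ((t f).1.1, (t f).1.2, (t f).2).
  by move=> /Hs/Ht; case: (t f) => [[]].
apply: (free_pivots (lam := fun f => (t f).1.1) (p := fun f => (t f).1.2)
                    (r := fun f => (t f).2)) => // [f fs|f g fs gs fg e rr].
  by have [? ->] := pivot_data_eigenfun (piv f fs); rewrite oner_neq0.
by apply: pivot_triangular (piv f fs) _ fg rr; rewrite e; apply: piv.
Qed.

End Listing.

Theorem theorem1p1 (R : realType) (d h : nat) (hd : (2 <= d)%N)
    (hh : (1 <= h)%N) :
  (* (a) *)
  (diagonalizable (Qmx R d h)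
   /\ (eigenval d h (1 : R[i]) /\ mup 1 (char_poly (Qmx R d h)) = 1%N)
   /\ (forall lam : R[i], eigenval d h lam -> lam <> 1 ->
       (* for d = 4, lam = 4/5 forces x = 1/2 = 1/sqrt d *)
       ~ (d = 4%N /\ lam = 4%:R / 5%:R) ->
       exists2 x : R[i], admissible d h x & lam = lambda d x)
   /\ (forall x : R[i], admissible d h x ->
       eigenval d h (lambda d x) /\ lambda d x <> 1)
   /\ (forall x : R[i], radial_eq d h x ->
       radial_eq d h (x * d%:R)^-1 /\ lambda d (x * d%:R)^-1 = lambda d x)
   /\ (forall (k : nat) (x : R[i]), (k < h)%N -> branch_eq d k x ->
       branch_eq d k (x * d%:R)^-1 /\ lambda d (x * d%:R)^-1 = lambda d x)
   /\ (forall x : R[i], admissible d h x ->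
       exists y : R[i], y <> x /\
         forall z : R[i],
           admissible d h z /\ lambda d z = lambda d x <-> z = x \/ z = y))
  (* (b) *)
  /\ ((forall x : R[i], nonexceptional d x -> radial_eq d h x ->
         eigenvector (lambda d x) (f_radial d h x))
      /\ (forall (k : nat) (x : R[i]) (v : tree d h) (j j' : 'I_d),
         (k < h)%N -> nonexceptional d x -> branch_eq d k x ->
         level v = (h - 1 - k)%N -> j' = j.+1 :> nat ->
         eigenvector (lambda d x) (f_branch k x v j j')))
  (* (c) *)
  /\ ((forall f : vec R d h, eigencollection f ->
         exists lam : R[i], eigenvector lam f)
      /\ exists s : seq (vec R d h),
           [/\ forall f : vec R d h, f \in s <-> eigencollection f,
               free s
               (* for d = 4 the eigenvectors for lam = 4/5 are missing *)
             & d <> 4%N -> basis_of fullv s]).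
Proof.
have span x (W : {vspace vec R d h}) f := eigenfun_nonexceptional hd hh (x := x) (W := W) (f := f).
split; [split; [|split; [|split; [|split; [|split; [|split]]]]]|split; [split|split]].
- exact: Qmx_diagonalizable.
- split; last exact: mup_char_poly1.
  exists (all_ones R d h); apply: (@eigenvector_pivot _ _ _ _ _ [bseq]).
    exact: eigenfun_all_ones.
  by rewrite ffunE.
- move=> lam [f [f0 Ef]] l1 n4; have [x x0 lE] := lambda_onto hd lam; subst lam.
  have [ax|nax] := EM (admissible d h x); first by exists x.
  case/eqP: f0; have [nx|nnx] := EM (nonexceptional d x); last first.
    exact: (eigenfun_exceptional hd hh x0 nnx n4).
  (* As [x] satisfies none of the equations, the zero space can be taken for [W]. *)
  apply/eqP; rewrite -memv0; apply: (span x) => //.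
    by move=> ex; case: nax; split=> //; left.
  by move=> k v j j' kh ex; case: nax; split=> //; right; exists k.
- move=> x ax; split; last exact: (admissible_lambda_neq1 hd ax).
  case: ax => nx [ex|[k kh ex]].
    by exists (f_radial d h x); apply: f_radial_eigenvector.
  (* The witness is the leftmost vertex of the required level, with its first two children. *)
  have vh : (size (nseq (h - 1 - k) (Ordinal (ltnW hd) : 'I_d)) <= h)%N.
    by rewrite size_nseq; lia.
  exists (f_branch k x (Bseq vh) (Ordinal (ltnW hd)) (Ordinal hd)).
  by apply: (f_branch_eigenvector hd hh kh nx ex); rewrite ?/level ?size_nseq.
- move=> x ex; split; first exact: radial_eq_inv.
  exact: lambda_inv (radial_eq_neq0 ex).
- move=> k x kh ex; split; first exact: branch_eq_inv.
  exact: lambda_inv (branch_eq_neq0 ex).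
- move=> x ax; have x0 := admissible_neq0 ax; exists (x * d%:R)^-1; split.
    (* A fixed point of the inversion satisfies [d * x ^+ 2 = 1], hence is exceptional. *)
    move=> xE; case: ax => /(nonexceptionalP hd) /eqP D0 _; apply: D0.
    by rewrite expr2 -{1}xE; field; rewrite x0 pnatr_eq0 -lt0n ltnW.
  move=> z; split=> [[az lz]|].
    exact: (lambda_eq hd (admissible_neq0 az) x0).1.
  case=> ->; first by [].
  by split; [apply: admissible_inv | apply: lambda_inv].
- by move=> x nx ex; apply: f_radial_eigenvector.
- move=> k x v j j' kh nx ex vk jj'; apply: (f_branch_eigenvector hd hh kh) => //.
  by rewrite -val_eqE /= jj' neq_ltn ltnSn.
- move=> f /[dup] cf; have [[[lam p] r] /[apply]] := pivot_data_ex hd hh f.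
  move=> /(pivot_data_eigenfun hd hh)[Ef fp].
  by exists lam; apply: eigenvector_pivot Ef fp.
have [s us Hs] := eigencollection_list R h hd.
have fs : free s by apply: (eigencollection_free hd hh us) => f /Hs.
exists s; split=> // d4; rewrite /basis_of fs andbT; apply/eqP.
(* By diagonalizability, it is enough that the span contains every eigenfunction. *)
apply: eigenfun_span => lam f Ef.
have [l1|l1] := EM (lam = 1).
  rewrite (eigenfun1 hd hh (f := f)) -?l1 //; apply/memvZ/memv_span/Hs.
  by constructor 1.
have [x x0 lE] := lambda_onto hd lam; subst lam.
have [nx|nnx] := EM (nonexceptional d x); last first.
  by rewrite (eigenfun_exceptional hd hh x0 nnx _ Ef) ?mem0v // => -[].
apply: (span x) Ef => // [ex|k v j j' kh ex vk jj'].
  by apply/memv_span/Hs; constructor 2; exists x.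
by apply/memv_span/Hs; constructor 3; exists k, x, v, j, j'.
Qed.
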